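(* Let $\mathfrak M$ be a partial Steiner triple system and $m\ge 3$ an integer. If $\mathfrak M$ does not contain any Veblen subconfiguration (is Pasch-free), then $\circledast^{m}\mathfrak M$ is Pasch-free as well.
   Context: A partial Steiner triple system (PSTS) is a structure $\mathfrak M=\langle S,\mathcal L\rangle$ with point set $S$ and a family $\mathcal L$ of 3-element subsets of $S$ (lines) such that any two distinct points lie on at most one line. $C_m$ is the cyclic group of integers modulo $m$. For an integer $m\ge 3$, the $m$-weaved configuration $\circledast^{m}\mathfrak M$ has point set $S\times C_m$ and its lines are all the sets $\{(a,i),(b,i),(c,i+1)\}$ with $\{a,b,c\}\in\mathcal L$ (in any ordering of $a,b,c$) and $i\in C_m$; it is again a PSTS. A Veblen (= Pasch) configuration consists of 6 points and 4 lines of size 3, any two of the lines meeting in a point and each point lying on exactly two of them. A PSTS contains it as a subconfiguration if there are 4 lines of the PSTS forming, with the 6 points on them, such a configuration; a PSTS is Pasch-free if it contains none. *)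

(* Defs.v *)
From mathcomp Require Import all_boot all_algebra.
From mathcomp Require Import classical_sets cardinality.
Set Implicit Arguments.
Unset Strict Implicit.
Unset Printing Implicit Defensive.
Import GRing.Theory.
Local Open Scope classical_set_scope.
Local Open Scope card_scope.

(* A structure <S, L> is given by its point type S, which may be infinite, and
   its family of lines L. *)
Definition is_psts (S : Type) (L : set (set S)) : Prop :=
  (forall l, L l -> l #= `I_3) /\
  (forall p q, p <> q -> forall l1 l2, L l1 -> L l2 ->
     l1 p -> l1 q -> l2 p -> l2 q -> l1 = l2).

(* ['Z_m] is the cyclic group C_m only for [1 < m].  As a, b, c are arbitrary
   names for the points of a line, every one of them is in turn the raised
   point; they are distinct because lines have three elements. *)
Definition weave (S : Type) (m : nat) (L : set (set S)) : set (set (S * 'Z_m)) :=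
  [set l | exists a b c (i : 'Z_m),
     L [set a; b; c] /\ l = [set (a, i); (b, i); (c, (i + 1)%R)]].
Arguments weave [S] m L.

Definition is_veblen (S : Type) (P : set S) (V : set (set S)) : Prop :=
  [/\ P #= `I_6,
      V #= `I_4,
      forall l, V l -> l `<=` P /\ l #= `I_3,
      forall l1 l2, V l1 -> V l2 -> l1 <> l2 -> exists p, l1 `&` l2 = [set p] &
      forall p, P p -> [set l | V l /\ l p] #= `I_2].

Definition pasch_free (S : Type) (L : set (set S)) : Prop :=
  ~ exists P V, V `<=` L /\ is_veblen P V.

(* Main.v *)
(** A Veblen configuration amounts to six points a, a', b, b', c, c' such that
    abc, ab'c', a'bc', a'b'c are lines.  Take one in the weave.  Each of its
    lines projects bijectively onto a line of the base.  If two of the opposite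
    points a, a' (or b, b', or c, c') have the same projection then, two points
    lying on at most one line, so do the other two pairs, and the four lines
    lie over one base line.  On each of them two of the second coordinates are
    equal to some i and the third is i + 1; if the first line has the
    coordinates i, i, i + 1, this rules out every value of the other three.
    Hence the projection is a Veblen configuration of the base. *)

Require Import Defs.
From mathcomp Require Import all_boot all_algebra.
From mathcomp Require Import boolp classical_sets cardinality.
Set Implicit Arguments.
Unset Strict Implicit.
Unset Printing Implicit Defensive.
Import GRing.Theory.
Local Open Scope classical_set_scope.
Local Open Scope card_scope.

(** * Finite sets listed by sequences without repetition *)

Lemma card_set_seq (T : choiceType) (s : seq T) :
  uniq s -> [set` s] #= `I_(size s).
Proof.
elim: s => [_|x s IHs /= /andP[xs us]]; first by rewrite set_nil II0.
apply/eq_cardSP; exists x; first by rewrite /= mem_head.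
suff -> : [set` x :: s] `\ x = [set` s] by exact: IHs.
apply/seteqP; split=> y /=.
  by rewrite inE => -[/orP[/eqP->|//]] /(_ erefl).
by move=> ys; rewrite inE ys orbT; split=> // yx; rewrite -yx ys in xs.
Qed.

Lemma card_set_seq_le (T : choiceType) (A : set T) (n : nat) (s : seq T) :
  A #= `I_n -> uniq s -> [set` s] `<=` A -> (size s <= n)%N.
Proof.
move=> An us /subset_card_le sA.
by rewrite -card_le_II -(card_le_eql (card_set_seq us)) -(card_le_eqr An).
Qed.

Lemma card_eq_set_seq (T : choiceType) (A : set T) (s : seq T) :
  A #= `I_(size s) -> uniq s -> [set` s] `<=` A -> A = [set` s].
Proof.
move=> An us sA; apply/seteqP; split=> // x Ax /=; apply/negPn/negP => xs.
have /= := @card_set_seq_le _ _ _ (x :: s) An; rewrite xs us ltnn => H.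
suff: false by []; apply: H => // y /=.
by rewrite inE => /orP[/eqP->|/sA].
Qed.

Lemma card_set_exists_seq (T : choiceType) (A : set T) (n : nat) :
  A #= `I_n -> exists s, [/\ uniq s, size s = n & [set` s] `<=` A].
Proof.
elim: n A => [|n IHn] A; first by move=> _; exists [::].
move=> /eq_cardSP[x Ax /IHn[s [us sn sA]]]; exists (x :: s).
rewrite /= us sn; split=> //.
  by rewrite andbT; apply/negP => /sA[_]; apply.
by move=> y /=; rewrite inE => /orP[/eqP->|/sA[]].
Qed.

Lemma uniq3 (T : eqType) (x y z : T) :
  uniq [:: x; y; z] = [&& x != y, x != z & y != z].
Proof. by rewrite /= !inE negb_or andbT andbA. Qed.

Lemma uniq4 (T : eqType) (x y z t : T) :
  uniq [:: x; y; z; t] =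
  [&& [&& x != y, x != z & x != t], (y != z) && (y != t) & z != t].
Proof. by rewrite /= !inE !negb_or andbT. Qed.

Lemma set3_seq (T : eqType) (a b c : T) : [set a; b; c] = [set` [:: a; b; c]].
Proof.
apply/seteqP; split=> x /=; rewrite !inE.
  by move=> [[|]|] ->; rewrite eqxx ?orbT.
by move=> /or3P[] /eqP ->; [left; left|left; right|right].
Qed.

(** Three distinct elements of the set all occur in the list [[:: a; b; c]], which leaves no room
    for a repetition. *)
Lemma card_set3_uniq (T : choiceType) (a b c : T) :
  [set a; b; c] #= `I_3 -> uniq [:: a; b; c].
Proof.
rewrite set3_seq => /card_set_exists_seq[s [us s3 sub]].
by apply: (leq_size_uniq us sub); rewrite s3.
Qed.

(** * Veblen configurations as six labelled points *)

(* Any two points named by different letters lie on one of the four lines, so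
   the six points are distinct once the lines have three points. *)
Definition has_pasch (S : Type) (L : set (set S)) : Prop :=
  exists a a' b b' c c', [/\ a <> a', b <> b', c <> c' &
    [/\ L [set a; b; c], L [set a; b'; c'],
        L [set a'; b; c'] & L [set a'; b'; c]]].

(** The six points are the pairwise intersections of the four lines. As each point has degree two,
    no three lines concur, so these intersections are distinct. *)
Lemma veblen_has_pasch (S : choiceType) (P : set S) (V : set (set S)) :
  is_veblen P V -> has_pasch V.
Proof.
move=> [_ cardV VP Vmeet Pdeg].
have concur l1 l2 l3 p : V l1 -> V l2 -> V l3 -> uniq [:: l1; l2; l3] ->
    l1 p -> l2 p -> l3 p -> False.
  move=> V1 V2 V3 u p1 p2 p3; have Pp : P p by apply: (VP _ V1).1.
  suff: (3 <= 2)%N by [].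
  apply: (card_set_seq_le (Pdeg p Pp) u) => l /=.
  by rewrite !inE => /or3P[] /eqP ->.
have lineE l x y z : V l -> l x -> l y -> l z ->
    x <> y -> x <> z -> y <> z -> V [set x; y; z].
  move=> Vl lx ly lz /eqP xy /eqP xz /eqP yz.
  rewrite set3_seq -(@card_eq_set_seq _ l [:: x; y; z]) //=.
  - exact: (VP _ Vl).2.
  - by rewrite !inE negb_or xy xz yz.
  - by move=> t /=; rewrite !inE => /or3P[] /eqP ->.
have [s [us s4 sV]] := card_set_exists_seq cardV.
case: s us s4 sV => [|l1 [|l2 [|l3 [|l4 [|//]]]]] // us _ sV.
have V1 : V l1 by apply: sV; rewrite /= !inE eqxx.
have V2 : V l2 by apply: sV; rewrite /= !inE eqxx ?orbT.
have V3 : V l3 by apply: sV; rewrite /= !inE eqxx ?orbT.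
have V4 : V l4 by apply: sV; rewrite /= !inE eqxx ?orbT.
move: us; rewrite uniq4 => /and3P[/and3P[n12 n13 n14] /andP[n23 n24] n34].
have meet l l' : V l -> V l' -> l != l' -> exists p, l p /\ l' p.
  move=> Vl Vl' /eqP /(Vmeet l l' Vl Vl')[p pE]; exists p.
  by have : (l `&` l') p by rewrite pE.
have [p12 [p12_1 p12_2]] := meet _ _ V1 V2 n12.
have [p13 [p13_1 p13_3]] := meet _ _ V1 V3 n13.
have [p14 [p14_1 p14_4]] := meet _ _ V1 V4 n14.
have [p23 [p23_2 p23_3]] := meet _ _ V2 V3 n23.
have [p24 [p24_2 p24_4]] := meet _ _ V2 V4 n24.
have [p34 [p34_3 p34_4]] := meet _ _ V3 V4 n34.
have c123 p : l1 p -> l2 p -> l3 p -> False.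
  by apply: concur => //; rewrite uniq3 n12 n13 n23.
have c124 p : l1 p -> l2 p -> l4 p -> False.
  by apply: concur => //; rewrite uniq3 n12 n14 n24.
have c134 p : l1 p -> l3 p -> l4 p -> False.
  by apply: concur => //; rewrite uniq3 n13 n14 n34.
have c234 p : l2 p -> l3 p -> l4 p -> False.
  by apply: concur => //; rewrite uniq3 n23 n24 n34.
(* Opposite points come from the three splittings of the four lines into two pairs. Identifying two
   of the points would make three lines concurrent. *)
by exists p12, p34, p13, p24, p14, p23; split;
  [move=> E; subst; eauto .. |
   split; [apply: (lineE l1) | apply: (lineE l2) |
           apply: (lineE l3) | apply: (lineE l4)]] => // E; subst; eauto.
Qed.

Lemma has_pasch_veblen (S : choiceType) (L : set (set S)) :
  (forall l, L l -> l #= `I_3) -> has_pasch L ->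
  exists P V, V `<=` L /\ is_veblen P V.
Proof.
move=> L3 [a [a' [b [b' [c [c' [aa' bb' cc' [L1 L2 L3' L4]]]]]]]].
have neq3 x y z : L [set x; y; z] -> [/\ x <> y, x <> z & y <> z].
  by move=> /L3 /card_set3_uniq; rewrite uniq3 => /and3P[] /eqP ? /eqP ? /eqP.
have [ab ac bc] := neq3 _ _ _ L1; have [ab' ac' bc'] := neq3 _ _ _ L2.
have [a'b a'c' bc1] := neq3 _ _ _ L3'; have [a'b' a'c b'c] := neq3 _ _ _ L4.
pose l1 := [set a; b; c]; pose l2 := [set a; b'; c'].
pose l3 := [set a'; b; c']; pose l4 := [set a'; b'; c].
(* Two of the lines are told apart by a point of the first missing from the second. *)
have separate (l l' : set S) x : l x -> ~ l' x -> l != l'.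
  by move=> lx l'x; apply/eqP => ll'; rewrite ll' in lx.
have n12 : l1 != l2.
  by apply: (separate _ _ b); rewrite /l1 /l2 /=; intuition congruence.
have n13 : l1 != l3.
  by apply: (separate _ _ a); rewrite /l1 /l3 /=; intuition congruence.
have n14 : l1 != l4.
  by apply: (separate _ _ a); rewrite /l1 /l4 /=; intuition congruence.
have n23 : l2 != l3.
  by apply: (separate _ _ a); rewrite /l2 /l3 /=; intuition congruence.
have n24 : l2 != l4.
  by apply: (separate _ _ a); rewrite /l2 /l4 /=; intuition congruence.
have n34 : l3 != l4.
  by apply: (separate _ _ b); rewrite /l3 /l4 /=; intuition congruence.
pose V := [set` [:: l1; l2; l3; l4]].
have VE l : V l -> [\/ l = l1, l = l2, l = l3 | l = l4].
  rewrite /V /mkset !in_cons => /or4P[/eqP->|/eqP->|/eqP->|].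
  - exact: Or41.
  - exact: Or42.
  - exact: Or43.
  - by rewrite orbF => /eqP ->; exact: Or44.
have meet (l l' : set S) p :
    l p -> l' p -> (forall q, l q -> l' q -> q = p) ->
    exists p, l `&` l' = [set p].
  move=> lp l'p pP; exists p; apply/seteqP; split=> q /=; last by move=> ->.
  by case; exact: pP.
have deg (l l' : set S) p : V l -> V l' -> l != l' -> l p -> l' p ->
    (forall k, V k -> k p -> k = l \/ k = l') ->
    [set k | V k /\ k p] #= `I_2.
  move=> Vl Vl' ll' lp l'p only.
  have -> : [set k | V k /\ k p] = [set` [:: l; l']].
    apply/seteqP; split=> k.
      by case=> /only kE /kE[] ->; rewrite /mkset !in_cons eqxx ?orbT.
    by rewrite /mkset !in_cons orbF => /orP[] /eqP ->.
  by apply: card_set_seq; rewrite /uniq !in_cons orbF ll'.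
exists [set` [:: a; a'; b; b'; c; c']], V; split.
  by move=> l /VE[] ->.
split.
- apply: card_set_seq.
  rewrite /= !inE !negb_or.
  by do !(apply/andP; split) => //; apply/eqP; congruence.
- by apply: card_set_seq; rewrite uniq4 n12 n13 n14 n23 n24 n34.
- move=> l Vl; split; last by apply: L3; case: (VE _ Vl) => ->.
  move=> p; rewrite /= !inE.
  by case: (VE _ Vl) => -> [[|]|] ->; rewrite eqxx ?orbT.
- move=> l l' /VE Vl /VE Vl'.
  (* Twelve ordered pairs of different lines remain; the witnesses are their common points. *)
  case: Vl => ->; case: Vl' => -> // _;
  [ apply: (meet _ _ a) | apply: (meet _ _ b) | apply: (meet _ _ c)
  | apply: (meet _ _ a) | apply: (meet _ _ c') | apply: (meet _ _ b')
  | apply: (meet _ _ b) | apply: (meet _ _ c') | apply: (meet _ _ a')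
  | apply: (meet _ _ c) | apply: (meet _ _ b') | apply: (meet _ _ a')];
  rewrite /l1 /l2 /l3 /l4 /=; intuition congruence.
- have V1 : V l1 by rewrite /V /mkset !in_cons eqxx.
  have V2 : V l2 by rewrite /V /mkset !in_cons eqxx ?orbT.
  have V3 : V l3 by rewrite /V /mkset !in_cons eqxx ?orbT.
  have V4 : V l4 by rewrite /V /mkset !in_cons eqxx ?orbT.
  move=> p; rewrite /= !inE.
  (* For [a], [a'], [b], [b'], [c], [c'] in turn, the two lines through that point. *)
  case/or4P => [|||/or3P[]] /eqP->;
  [ apply: (deg l1 l2) | apply: (deg l3 l4) | apply: (deg l1 l3)
  | apply: (deg l2 l4) | apply: (deg l1 l4) | apply: (deg l2 l3)] => //;
  try (by move=> k /VE[] ->; rewrite /l1 /l2 /l3 /l4 /=; intuition congruence);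
  rewrite /l1 /l2 /l3 /l4 /=; intuition congruence.
Qed.

(** The two lines share the distinct points [a] and [b], hence coincide; [c] differs from both, so
    it must be [c']. *)
Lemma psts_third_inj (S : choiceType) (L : set (set S)) (a b c c' : S) :
  is_psts L -> L [set a; b; c] -> L [set a; b; c'] -> c = c'.
Proof.
move=> [L3 lin] abc abc'.
have := card_set3_uniq (L3 _ abc); rewrite uniq3 => /and3P[/eqP ab ac bc].
have E : [set a; b; c] = [set a; b; c'].
  by apply: (lin a b) => //=; rewrite ?inE; intuition.
have : [set a; b; c'] c by rewrite -E; right.
by move=> [[|]|] //= cE; rewrite cE eqxx in ac bc.
Qed.

(** * Second coordinates along the lines of a weave *)

Section Levels.

Local Open Scope ring_scope.
Variable R : nzRingType.
Implicit Types x y z : R.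

(** The disjuncts correspond to the third, the second and the first point being the raised one. *)
Definition weave_levels x y z : Prop :=
  [\/ x = y /\ z = x + 1, x = z /\ y = x + 1 | y = z /\ x = y + 1].

Lemma weave_levelsAC x y z : weave_levels x y z -> weave_levels x z y.
Proof. by case=> -[-> ->]; [apply: Or32|apply: Or31|apply: Or33]. Qed.

Lemma weave_levels_rot x y z : weave_levels x y z -> weave_levels y z x.
Proof. by case=> -[-> ->]; [apply: Or32|apply: Or33|apply: Or31]. Qed.

Lemma addr1_neq x : x <> x + 1.
Proof.
move=> /eqP; rewrite -subr_eq0 opprD addrA subrr add0r oppr_eq0.
by rewrite oner_eq0.
Qed.

(** With [y = x], the second and third lines leave only [x' = y' = x + 1], [z' = x], or
    [x' = y' = z' = x - 1]. On the fourth line the first two levels then agree, so its third level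
    [x + 1] should be [x' + 1]; it is [x'] or [x' + 2] instead. *)
Lemma weave_levels_no_pasch_base x x' y y' z z' :
  x = y -> z = x + 1 -> x <> x' -> y <> y' -> z <> z' ->
  weave_levels x y' z' -> weave_levels x' y z' -> weave_levels x' y' z -> False.
Proof.
move=> <- -> xx' xy' zz'.
have n := addr1_neq.
case=> -[E1 E2]; case=> -[E3 E4]; case=> -[E5 E6]; subst; try congruence.
all: by [exact: n E5 | exact: n E6 | exact: n (esym E6) | exact: n E4].
Qed.

(** Permuting the three opposite pairs preserves the pattern of four lines, so the raised point of
    the first line may be put third. *)
Lemma weave_levels_no_pasch x x' y y' z z' :
  x <> x' -> y <> y' -> z <> z' -> weave_levels x y z ->
  weave_levels x y' z' -> weave_levels x' y z' -> weave_levels x' y' z -> False.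
Proof.
move=> xx' yy' zz' [[e1 e2]|[e1 e2]|[e1 e2]] w2 w3 w4.
- exact: (weave_levels_no_pasch_base e1 e2 xx' yy' zz').
- by apply: (weave_levels_no_pasch_base e1 e2 xx' zz' yy');
    exact: weave_levelsAC.
- apply: (weave_levels_no_pasch_base e1 e2 yy' zz' xx');
    exact: weave_levels_rot.
Qed.

End Levels.

(** * Projecting the weave to the base *)

Lemma weave_line (S : choiceType) (m : nat) (L : set (set S))
    (p q r : S * 'Z_m) :
  (forall l, L l -> l #= `I_3) -> weave m L [set p; q; r] ->
  L [set p.1; q.1; r.1] /\ weave_levels p.2 q.2 r.2.
Proof.
move=> L3 [a [b [c [i [Labc E]]]]].
have E1 : [set p.1; q.1; r.1] = [set a; b; c].
  by have := congr1 (fun A => fst @` A) E; rewrite !image_setU !image_set1.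
have Lpqr : L [set p.1; q.1; r.1] by rewrite E1.
split=> //.
have := card_set3_uniq (L3 _ Lpqr); rewrite uniq3.
move=> /and3P[/eqP pq /eqP pr /eqP qr].
have on s : [set p; q; r] s ->
    [\/ s = (a, i), s = (b, i) | s = (c, (i + 1)%R)].
  by rewrite E => -[[|]|] ->; [exact: Or31|exact: Or32|exact: Or33].
have Dp := on p (or_introl (or_introl erefl)).
have Dq := on q (or_introl (or_intror erefl)).
have Dr := on r (or_intror erefl).
(* Distinct projections exclude repeated choices; the six orderings of the three points remain. *)
move: pq pr qr; case: Dp => ->; case: Dq => ->; case: Dr => -> //= _ _ _.
- exact: Or31.
- exact: Or32.
- exact: Or31.
- exact: Or32.
- exact: Or33.
- exact: Or33.
Qed.

Lemma weave_has_pasch (S : choiceType) (m : nat) (L : set (set S)) :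
  is_psts L -> has_pasch (weave m L) -> has_pasch L.
Proof.
move=> psts [p [p' [q [q' [r [r' [pp' qq' rr' [l1 l2 l3 l4]]]]]]]].
have [L1 W1] := weave_line psts.1 l1; have [L2 W2] := weave_line psts.1 l2.
have [L3 W3] := weave_line psts.1 l3; have [L4 W4] := weave_line psts.1 l4.
(* A cycle of implications makes the three coincidences equivalent. Each compares the first line
   with another one that, after the identification, shares two points with it. *)
have ac : p.1 = p'.1 -> r.1 = r'.1.
  by move=> e; rewrite -e in L3; exact: psts_third_inj L1 L3.
have cb : r.1 = r'.1 -> q.1 = q'.1.
  move=> e; rewrite -e setUAC in L2; rewrite setUAC in L1.
  exact: psts_third_inj L1 L2.
have ba : q.1 = q'.1 -> p.1 = p'.1.
  move=> e; rewrite -e -setUA setUC in L4; rewrite -setUA setUC in L1.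
  exact: psts_third_inj L1 L4.
have [e|ne] := pselect (p.1 = p'.1).
  have fib (s t : S * 'Z_m) : s.1 = t.1 -> s <> t -> s.2 <> t.2.
    by case: s t => [s1 s2] [t1 t2] /= -> st st2; apply: st; rewrite st2.
  case: (weave_levels_no_pasch (fib _ _ e pp') (fib _ _ (cb (ac e)) qq')
    (fib _ _ (ac e) rr') W1 W2 W3 W4).
by exists p.1, p'.1, q.1, q'.1, r.1, r'.1; split=> //;
  [move=> e; apply/ne/ba|move=> e; apply/ne/ba/cb].
Qed.

Theorem corollary2p5 (S : Type) (L : set (set S)) (m : nat) :
  is_psts L -> (3 <= m)%N -> pasch_free L -> pasch_free (weave m L).
Proof.
move=> psts _ free [P [V [VL veb]]]; apply: free.
(* [{classic S}] gives the arbitrary type [S] the choice structure on which the listing of finite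
   sets relies. *)
apply: (@has_pasch_veblen {classic S}); first exact: psts.1.
apply: (@weave_has_pasch {classic S} m) => //.
have [a [a' [b [b' [c [c' [? ? ? [? ? ? ?]]]]]]]] :=
  @veblen_has_pasch ({classic S} * 'Z_m)%type P V veb.
by exists a, a', b, b', c, c'; split=> //; split; exact: VL.
Qed.
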